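(* Let $G$ be a group with decidable word problem, with set of generators $\Sigma=\{x_1,\dots,x_m,x_1^{-1},\dots,x_m^{-1}\}$ and identity $e$, and let $\mathfrak{L}(G)=\{\omega\in\Sigma^*\mid\omega\equiv e\ (\mathrm{mod}\ G)\}$. Let $L$ be a linear language and let $L=L(\Gamma)$, where $\Gamma=(N,\Sigma,\Pi,A_1)$ is a linear grammar with $N=\{A_1,\dots,A_n\}$. Let $r$ be the constant of the pumping lemma for the context-free language $L$. With the notation of the context, define $$\Omega_1=\{\,\omega\in L\mid |\omega|\le r\,\},$$ $$\Omega_2=\{\,uwvw^{-1}\mid |uwv|\le r,\ uv\neq\varepsilon,\ \exists B\in N:\ B\stackrel{*}{\Rightarrow}uBv,\ B\stackrel{*}{\Rightarrow}w\,\},$$ $$\Omega_7=\{\,f_d(l_U(\pi))\mid\pi\in\widehat{D_{1\,n+1}}\,\},$$ $$\Omega_8=\{\,\langle f_l(l_U(\pi_2)),f_d(l_U(\pi_3)),f_r(l_U(\pi_2))\rangle\mid \exists\pi\in D_{1\,n+1}:\ \pi=\pi_1\pi_2\pi_3,\ \pi_1\in D_{1i},\ \pi_2\in C_i,\ \pi_3\in\widehat{D_{i\,n+1}},\ 1\le i\le n\,\},$$ $$\Omega_9=f_d(g_{1\,n+1}^n),$$ $$\Omega_{10}=\bigcup\{\,\langle f_l(g_{ii}^n),f_d(g_{i\,n+1}^n),f_r(g_{ii}^n)\rangle\mid 1\le i\le n,\ \mathcal{K}_{1i}^n\neq\emptyset,\ \mathcal{K}_{ii}^n\neq\emptyset,\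 \mathcal{K}_{i\,n+1}^n\neq\emptyset\,\},$$ and put $W_1=\Omega_1\cup\Omega_2$ (its words being regarded as elements of $G$), $W_4=\Omega_7\cup\Omega_8$, $W_5=\Omega_9\cup\Omega_{10}$. Then the following conditions are equivalent: (i) $L\subseteq\mathfrak{L}(G)$; (ii) $W_1=\Omega_1\cup\Omega_2=\{e\}$; (iii) $W_4=\Omega_7\cup\Omega_8=\{e\}$; (iv) $W_5=\Omega_9\cup\Omega_{10}=\{e\}$.
   Context: $\Sigma^*$ is the free monoid over the finite alphabet $\Sigma$, $\varepsilon$ the empty word, $|\omega|$ the length of $\omega$; the letter $x_i^{-1}$ represents in $G$ the inverse of the element represented by $x_i$, and $w^{-1}$ denotes the inverse word of $w$ (letters inverted and in reversed order). $\omega\equiv e\ (\mathrm{mod}\ G)$ means that $\omega$ evaluates to the identity in $G$. A context-free grammar $\Gamma=(N,\Sigma,\Pi,A_1)$ (variables $N$, terminals $\Sigma$, productions $\Pi$, start variable $A_1$) is linear if all its productions have the form $A_i\to\alpha A_j\beta$ or $A_i\to\alpha$ with $A_i,A_j\in N$ and $\alpha,\beta\in\Sigma^*$; a language is linear if it is generated by a linear grammar. $\stackrel{*}{\Rightarrow}$ denotes derivability; $u,v,w$ in $\Omega_2$ are words over $\Sigma$. The constant $r$ of the pumping lemma for $L$ is the number such that every $z\in L$ with $|z|\ge r$ can be written $z=z_1uwvz_2$ with $|uwv|\le r$, $uv\ne\varepsilon$ and $z_1u^iwv^iz_2\in L$ for all $i\ge 0$. $U_G=G\times G$ is the group with operation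 $(x,y)\diamond(z,t)=(xz,ty)$. The maps $f_l,f_r,f_d:U_G\to G$ are $f_l(x,y)=x$, $f_r(x,y)=y$, $f_d(x,y)=xy$, extended to subsets elementwise. For subsets $X,Y,Z$ of $G$, $\langle X,Y,Z\rangle=\{xyzy^{-1}\mid x\in X,\ y\in Y,\ z\in Z\}$; for single elements $x,y,z$ of $G$, $\langle x,y,z\rangle$ is $xyzy^{-1}$. Transition diagram $H_U$: the directed multigraph with vertex set $V=N\cup\{A_{n+1}\}$, $A_{n+1}\notin N$, and arcs: for each production $A_i\to\alpha A_j\beta$ in $\Pi$ with $A_i,A_j\in N$, an arc from $A_i$ to $A_j$ labeled $(\alpha,\beta)$; for each production $A_i\to\alpha$ in $\Pi$ with $\alpha\in\Sigma^*$, an arc from $A_i$ to $A_{n+1}$ labeled $(\alpha,\varepsilon)$; no other arcs. Labels are regarded as elements of $U_G$ (both words evaluated in $G$); this labeling is $l_U$. For a walk $\pi=p_1\cdots p_k$ (a sequence of consecutive arcs), $l_U(\pi)=l_U(p_1)\diamond\cdots\diamond l_U(p_k)$; for a set $P$ of walks, $l_U(P)=\{l_U(\pi)\mid\pi\in P\}$. Sets of walks in $H_U$, for $1\le i\le n$, $1\le j\le n+1$: $D_{ij}$ is the set of all walks from $A_i$ to $A_j$; $\widehat{D_{ij}}\subseteq D_{ij}$ is the set of those in which all vertices are distinct, except possibly $A_i=A_j$; $C_i=\widehat{D_{ii}}$. For $1\le i\le n$, $1\le j\le n+1$, $0\le k\le n$: $\mathcal{K}_{ij}^0$ is the set of all arcs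 from $A_i$ to $A_j$, and for $k\ge1$, $\mathcal{K}_{ij}^k=\mathcal{K}_{ij}^{k-1}\cup\mathcal{K}_{ik}^{k-1}\mathcal{K}_{kj}^{k-1}$, where the product is the set of concatenations. Put $g_{ij}^k=l_U(\mathcal{K}_{ij}^k)\subseteq U_G$ (the superscript $k$ is an index, not an exponent).
   Formalization: Assumed in addition: L is nonempty; every variable is reachable from A_1; the factorization z=z_1uwvz_2 given by r comes from Γ (A_1⇒*z_1Bz_2, B⇒*uBv, B⇒*w). In Ω_10 the outer entries f_l, f_r are taken from the same element of g_ii^n, not independently. *)

(* Defs.v *)
From Stdlib Require Import Relation_Operators.
From mathcomp Require Import all_boot.
From mathcomp Require Import classical_sets.

Set Implicit Arguments.
Unset Strict Implicit.
Unset Printing Implicit Defensive.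

Local Open Scope classical_set_scope.
Local Open Scope group_scope.

(** * Words over the alphabet x_1, ..., x_m, x_1^{-1}, ..., x_m^{-1} *)

(* [(i, false)] is the letter x_i and [(i, true)] the formal letter x_i^{-1}. *)
Notation letter m := ('I_m * bool)%type.
Notation word m := (seq (letter m)).

Definition inv_word (m : nat) (w : word m) : word m :=
  rev [seq (a.1, ~~ a.2) | a <- w].

Section Evaluation.
Context (G : groupType) (m : nat) (x : 'I_m -> G).

Definition eval_letter (a : letter m) : G := if a.2 then (x a.1)^-1 else x a.1.

Definition eval (w : word m) : G := \prod_(a <- w) eval_letter a.

Definition generating : Prop := forall g : G, exists w : word m, eval w = g.

Definition identity_words : set (word m) := [set w | eval w = 1].

End Evaluation.

(** * Decidability of the word problem *)

(* Being decidable is expressed with partial recursive functions: a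
   [{P} + {~ P}] statement would be void here, because equality in a
   [groupType] is already boolean. *)
Inductive recfun : Type :=
  | RZero
  | RSucc
  | RProj of nat
  | RComp of recfun & seq recfun
  | RPrim of recfun & recfun
  | RMin of recfun.

(* [reval f s y]: on the arguments [s], [f] is defined and has value [y]. *)
Inductive reval : recfun -> seq nat -> nat -> Prop :=
  | REZero s : reval RZero s 0
  | RESucc a s : reval RSucc (a :: s) a.+1
  | REProj i s of i < size s : reval (RProj i) s (nth 0 s i)
  | REComp f gs s ys y of size ys = size gs
      & (forall i, i < size gs -> reval (nth RZero gs i) s (nth 0 ys i))
      & reval f ys y : reval (RComp f gs) s y
  | REPrim0 f g s y of reval f s y : reval (RPrim f g) (0 :: s) y
  | REPrimS f g k s z y of reval (RPrim f g) (k :: s) z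
      & reval g [:: k, z & s] y : reval (RPrim f g) (k.+1 :: s) y
  | REMin f k s (ys : nat -> nat) of reval f (k :: s) 0
      & (forall i, i < k -> reval f (i :: s) (ys i).+1) :
      reval (RMin f) s k.

Definition word_code (m : nat) (w : word m) : nat :=
  CodeSeq.code [seq (val a.1).*2 + a.2 | a : letter m <- w].

Definition decidable_word_problem (G : groupType) (m : nat) (x : 'I_m -> G) :
    Prop :=
  exists f : recfun,
    forall w : word m, reval f [:: word_code w] (eval x w == 1).

(** * Context-free grammars *)

(* The variables are A_1, ..., A_{n+1}, encoded as [0, ..., n : 'I_n.+1]; the
   number of variables, at least 1, is thus [n.+1]. *)
Notation symbol m n := ('I_n.+1 + letter m)%type.

Record grammar (m n : nat) : Type := Grammar {
  productions : seq ('I_n.+1 * seq (symbol m n))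
}.

Section Grammar.
Context (m n : nat).
Implicit Types (Gam : grammar m n) (L : set (word m)).

Definition start : 'I_n.+1 := ord0.

Definition terminals (w : word m) : seq (symbol m n) := [seq inr a | a <- w].

Definition one_var (u : word m) (B : 'I_n.+1) (v : word m) :
    seq (symbol m n) :=
  terminals u ++ inl B :: terminals v.

Definition derives1 Gam (s t : seq (symbol m n)) : Prop :=
  exists (A : 'I_n.+1) (rhs a b : seq (symbol m n)),
    [/\ (A, rhs) \in productions Gam, s = a ++ inl A :: b & t = a ++ rhs ++ b].

Definition derives Gam : seq (symbol m n) -> seq (symbol m n) -> Prop :=
  clos_refl_trans _ (derives1 Gam).

Definition language Gam : set (word m) :=
  [set w | derives Gam [:: inl start] (terminals w)].

Definition linear_grammar Gam : Prop :=
  forall A rhs, (A, rhs) \in productions Gam ->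
    (exists u B v, rhs = one_var u B v) \/ (exists u, rhs = terminals u).

(* [Omega2] below ranges over all variables, reachable or not: the loops of an
   unreachable variable would put into it words unrelated to the language. *)
Definition all_reachable Gam : Prop :=
  forall B : 'I_n.+1, exists a b : seq (symbol m n),
    derives Gam [:: inl start] (a ++ inl B :: b).

Definition word_pow (u : word m) (i : nat) : word m := flatten (nseq i u).

(* The pumping lemma for the language generated by [Gam], with constant [r].
   The last clause records where the factorization comes from in the proof of
   that lemma, namely from a variable repeated in a derivation of [z]. The
   clause on [i] follows from it, but the converse fails: a constant that is
   only good for [L] as a language says nothing about the loops of [Gam]. *)
Definition pumping_constant Gam L (r : nat) : Prop :=
  forall z, L z -> r <= size z ->
    exists z1 u w v z2 : word m,
      [/\ z = z1 ++ u ++ w ++ v ++ z2,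
          size (u ++ w ++ v) <= r,
          u ++ v <> [::],
          (forall i, L (z1 ++ word_pow u i ++ w ++ word_pow v i ++ z2))
        & exists B : 'I_n.+1,
            [/\ derives Gam [:: inl start] (one_var z1 B z2),
                derives Gam [:: inl B] (one_var u B v)
              & derives Gam [:: inl B] (terminals w)]].

Definition Omega1 L (r : nat) : set (word m) := [set z | L z /\ size z <= r].

Definition Omega2 Gam (r : nat) : set (word m) :=
  [set z | exists u w v : word m,
     [/\ z = u ++ w ++ v ++ inv_word w,
         size (u ++ w ++ v) <= r,
         u ++ v <> [::]
       & exists B : 'I_n.+1,
           derives Gam [:: inl B] (one_var u B v) /\
           derives Gam [:: inl B] (terminals w)]].

End Grammar.

Arguments start {n}.

Definition W1 (G : groupType) (m n : nat) (x : 'I_m -> G)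
    (Gam : grammar m n) (L : set (word m)) (r : nat) : set G :=
  eval x @` (Omega1 L r `|` Omega2 Gam r).

(** * The group U_G *)

Section UG.
Context (G : groupType).

Definition diamond (p q : G * G) : G * G := (p.1 * q.1, q.2 * p.2).

Definition f_l (p : G * G) : G := p.1.
Definition f_r (p : G * G) : G := p.2.
Definition f_d (p : G * G) : G := p.1 * p.2.

Definition angle (x y z : G) : G := x * y * z * y^-1.

End UG.

(** * The transition diagram H_U *)

(* [Some i] is the vertex A_i, and [None] the additional final vertex. *)
Notation vertex n := (option 'I_n.+1).

(* The labels are kept as pairs of words, so that distinct productions give
   distinct arcs of the multigraph even if their labels agree in U_G. *)
Record darc (m n : nat) : Type := DArc {
  src : 'I_n.+1;
  tgt : vertex n;
  label : word m * word m
}.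

Section Diagram.
Context (G : groupType) (m n : nat) (x : 'I_m -> G) (Gam : grammar m n).
Implicit Types (i : 'I_n.+1) (j : vertex n) (a : darc m n) (p : seq (darc m n)).

Definition is_arc a : Prop :=
  match tgt a with
  | Some B =>
      (src a, one_var (label a).1 B (label a).2) \in productions Gam
  | None =>
      (src a, terminals n (label a).1) \in productions Gam /\
      (label a).2 = [::]
  end.

Fixpoint is_path (j0 : vertex n) p (j : vertex n) : Prop :=
  if p is a :: p' then
    [/\ Some (src a) = j0, is_arc a & is_path (tgt a) p' j]
  else j0 = j.

(* Walks consist of at least one arc. *)
Definition D i j : set (seq (darc m n)) :=
  [set p | p <> [::] /\ is_path (Some i) p j].

(* On the vertices v_0, ..., v_k of a walk, the two [uniq] conditions together
   say that v_s = v_t with s < t is possible only for s = 0 and t = k. *)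
Definition Dhat i j : set (seq (darc m n)) :=
  [set p | [/\ D i j p, uniq [seq src a | a <- p] & uniq [seq tgt a | a <- p]]].

Definition C i : set (seq (darc m n)) := Dhat i (Some i).

Definition l_arc a : G * G := (eval x (label a).1, eval x (label a).2).

Definition l_U p : G * G :=
  foldr (fun a => diamond (l_arc a)) (1, 1) p.

Definition Omega7 : set G := [set f_d (l_U p) | p in Dhat start None].

Definition Omega8 : set G :=
  [set g | exists i (p1 p2 p3 : seq (darc m n)),
     [/\ [/\ D start (Some i) p1, C i p2 & Dhat i None p3],
         D start None (p1 ++ p2 ++ p3)
       & g = angle (f_l (l_U p2)) (f_d (l_U p3)) (f_r (l_U p2))]].

Definition W4 : set G := Omega7 `|` Omega8.

(* With variables numbered from 0, step [k.+1] goes through variable [k]. *)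
Fixpoint K (k : nat) i j : set (seq (darc m n)) :=
  if k is k'.+1 then
    K k' i j `|`
    [set p ++ q | p in K k' i (Some (inord k')) & q in K k' (inord k') j]
  else
    [set p | exists a, [/\ p = [:: a], is_arc a, src a = i & tgt a = j]].

Definition g (k : nat) i j : set (G * G) := l_U @` K k i j.

Definition Omega9 : set G := [set f_d q | q in g n.+1 start None].

(* The two outer entries of the bracket come from one and the same element of
   g_ii, as in [Omega8]. They cannot vary independently: with the productions
   A_1 -> x A_1 x^{-1} and A_1 -> empty word, every word of the language is
   trivial, but g_11 contains both (x, x^{-1}) and (x^2, x^{-2}). *)
Definition Omega10 : set G :=
  [set h | exists i,
     [/\ K n.+1 start (Some i) !=set0,
         K n.+1 i (Some i) !=set0,
         K n.+1 i None !=set0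
       & exists p q : G * G, [/\ g n.+1 i (Some i) p, g n.+1 i None q
           & h = angle (f_l p) (f_d q) (f_r p)]]].

Definition W5 : set G := Omega9 `|` Omega10.

End Diagram.

(* Main.v *)
(** All three conditions are compared with (i) by removing loops. If a word
    [z1 u w v z2] of [L] comes from a loop [B => u B v] followed by [B => w],
    then [z1 w z2] is also in [L], and it has the same value in [G] exactly
    when [u w v w^-1 = 1]. So (i) forces every such bracket to be trivial;
    conversely, trivial brackets allow one to shorten a word (through the
    pumping lemma) or a walk (by cutting its last simple loop) until it is
    short, resp. simple. The sets of (iv) contain those of (iii), since
    [K n.+1] contains every walk without repeated intermediate vertices. *)
Require Import Defs.
From Stdlib Require Import Relation_Operators Operators_Properties.
From mathcomp Require Import all_boot.
From mathcomp Require Import classical_sets.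
From mathcomp Require Import zify.

Set Implicit Arguments.
Unset Strict Implicit.
Unset Printing Implicit Defensive.

Local Open Scope classical_set_scope.
Local Open Scope group_scope.

(** * Singletons and brackets in a group *)

Lemma subset1_eq (T : Type) (A : set T) (t : T) :
  A !=set0 -> A `<=` [set t] -> A = [set t].
Proof.
move=> [s As] sAt; apply/seteqP; split=> // _ ->.
by rewrite -(sAt _ As).
Qed.

Lemma angle_eq1 (G : groupType) (u w v : G) :
  angle u w v = 1 <-> u * w * v = w.
Proof.
by split=> [/divg1_eq|h]; last by rewrite /angle h mulgV.
Qed.

(** The context [a], [b] is the same around [w] and around [u * w * v], so it cancels. *)
Lemma angle_loop (G : groupType) (a b u w v : G) :
  a * w * b = 1 -> a * (u * w * v) * b = 1 -> angle u w v = 1.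
Proof.
by move=> h1 h2; apply/angle_eq1/(mulgI a)/(mulIg b); rewrite h1 h2.
Qed.

(** * Values of words in the group *)

Section Words.
Context (G : groupType) (m : nat) (x : 'I_m -> G).
Implicit Types u v w : word m.

Lemma eval_cat u v : eval x (u ++ v) = eval x u * eval x v.
Proof. exact: big_cat. Qed.

Lemma eval_inv_word w : eval x (inv_word w) = (eval x w)^-1.
Proof.
elim: w => [|[i b] w IHw]; first by rewrite /eval !big_nil invg1.
rewrite /inv_word /= rev_cons -cats1 eval_cat -/(inv_word w) IHw.
rewrite -[_ :: w]cat1s eval_cat invgM /eval !big_seq1 /eval_letter /=.
by case: b => //=; rewrite invgK.
Qed.

Lemma eval_Omega2 u w v :
  eval x (u ++ w ++ v ++ inv_word w) = angle (eval x u) (eval x w) (eval x v).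
Proof. by rewrite !eval_cat eval_inv_word /angle !mulgA. Qed.

End Words.

(** * Derivations in a linear grammar *)

Section LinearDerivations.
Context (m n : nat) (Gam : grammar m n).
Implicit Types (u v w : word m) (s t : seq (symbol m n)).

Lemma terminals_cat u v : terminals n (u ++ v) = terminals n u ++ terminals n v.
Proof. exact: map_cat. Qed.

Lemma terminals_inj : injective (@terminals m n).
Proof. by apply: inj_map => ? ? []. Qed.

Lemma var_notin_terminals (A : 'I_n.+1) w : inl A \notin terminals n w.
Proof. by apply/negP => /mapP[]. Qed.

(** Terminal words contain no variable, so a derivation step has no choice of where to act. *)
Lemma one_var_inj u B v (s t : seq (symbol m n)) (A : 'I_n.+1) :
  one_var u B v = s ++ inl A :: t ->
  [/\ s = terminals n u, A = B & t = terminals n v].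
Proof.
rewrite /one_var; elim: u s => [|a u IHu] [|b s] //=.
- by move=> [-> ->].
- move=> [_ /esym ets]; have := var_notin_terminals A v.
  by rewrite -ets mem_cat mem_head orbT.
- by move=> [-> /IHu[-> -> ->]].
Qed.

Lemma derives_cat s1 s2 s t :
  derives Gam s t -> derives Gam (s1 ++ s ++ s2) (s1 ++ t ++ s2).
Proof.
elim=> {s t} [s t [A [rhs [a [b [AP -> ->]]]]]|s|s t t' _ h1 _ h2].
- apply: rt_step; exists A, rhs, (s1 ++ a), (b ++ s2).
  by rewrite -!catA.
- exact: rt_refl.
- exact: rt_trans h1 h2.
Qed.

Lemma derives_one_var u v s (B : 'I_n.+1) :
  derives Gam [:: inl B] s ->
  derives Gam (one_var u B v) (terminals n u ++ s ++ terminals n v).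
Proof. exact: derives_cat. Qed.

Hypothesis hlin : linear_grammar Gam.

Lemma derives1_one_var u B v s :
  derives1 Gam (one_var u B v) s ->
  (exists u' B' v', (B, one_var u' B' v') \in productions Gam /\
     s = one_var (u ++ u') B' (v' ++ v)) \/
  (exists u', (B, terminals n u') \in productions Gam /\
     s = terminals n (u ++ u' ++ v)).
Proof.
move=> [A [rhs [a [b [AP /one_var_inj[-> eAB ->] ->]]]]].
rewrite {}eAB in AP.
case: (hlin AP) => [[u' [B' [v' e]]]|[u' e]]; rewrite {}e in AP *.
- left; exists u', B', v'; split=> //.
  by rewrite /one_var !terminals_cat -!catA.
- by right; exists u'; rewrite !terminals_cat.
Qed.

Lemma derives1_terminals w s : ~ derives1 Gam (terminals n w) s.
Proof.
move=> [A [rhs [a [b [_ e _]]]]]; have := var_notin_terminals A w.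
by rewrite e mem_cat mem_head orbT.
Qed.

Lemma derives_form u B v s :
  derives Gam (one_var u B v) s ->
  (exists u' B' v', s = one_var u' B' v') \/ (exists w, s = terminals n w).
Proof.
move=> h; have d := clos_rt_rtn1 _ _ _ _ h.
elim: d => {s h} [|s t st _ [[u' [B' [v' e]]]|[w e]]].
- by left; exists u, B, v.
- rewrite {}e in st.
  case: (derives1_one_var st) => [[u2 [B2 [v2 [_ ->]]]]|[w [_ ->]]].
  + by left; do 3!eexists.
  + by right; eexists.
- by rewrite e in st; case: (derives1_terminals st).
Qed.

(** Linear productions never create a second variable, so the context in which [B] is reached is
    terminal. *)
Lemma reachable_one_var (B : 'I_n.+1) :
  all_reachable Gam -> exists u v, derives Gam [:: inl start] (one_var u B v).
Proof.
move=> /(_ B)[s [t dst]].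
have [[u [A [v /esym e]]]|[w e]] := @derives_form [::] start [::] _ dst.
  by have [es eB et] := one_var_inj e; exists u, v; rewrite es et in dst.
by have := var_notin_terminals B w; rewrite -e mem_cat mem_head orbT.
Qed.

End LinearDerivations.

(** * Derivations as walks in the diagram *)

Section Walks.
Context (m n : nat) (Gam : grammar m n).
Implicit Types (i : 'I_n.+1) (j : vertex n) (p q : seq (darc m n)).

Definition left_word p : word m := flatten [seq (label a).1 | a <- p].
(** Each later production puts its right part to the left of the earlier ones, hence [rev];
    [diamond] reverses its second component accordingly. *)
Definition right_word p : word m := flatten (rev [seq (label a).2 | a <- p]).

Lemma right_word_cons a p : right_word (a :: p) = right_word p ++ (label a).2.
Proof. by rewrite /right_word /= rev_cons flatten_rcons. Qed.

Lemma is_path_cat j0 p q j :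
  is_path Gam j0 (p ++ q) j <->
  exists j1, is_path Gam j0 p j1 /\ is_path Gam j1 q j.
Proof.
elim: p j0 => [|a p IHp] j0 /=.
  by split=> [h|[j1 [<- //]]]; exists j0.
split=> [[ea aa /IHp[j1 [h1 h2]]]|[j1 [[ea aa h1] h2]]]; first by exists j1.
by split=> //; apply/IHp; exists j1.
Qed.

Lemma is_path_cat_src j0 p a q j :
  is_path Gam j0 (p ++ a :: q) j ->
  is_path Gam j0 p (Some (src a)) /\ is_path Gam (Some (src a)) (a :: q) j.
Proof. by move=> /is_path_cat[j1 [h1 /= [e h2 h3]]]; rewrite e. Qed.

Lemma path_derives p i :
  is_path Gam (Some i) p None ->
  derives Gam [:: inl i] (terminals n (left_word p ++ right_word p)).
Proof.
elim: p i => [//|[B [C|] [u v]] p IHp] i /= [[<-]]; rewrite /is_arc /=.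
  move=> BP /IHp dC; rewrite right_word_cons /left_word /= -/(left_word p).
  apply: rt_trans (_ : derives Gam _ (one_var u C v)) _.
    by apply: rt_step; exists B, (one_var u C v), [::], [::]; rewrite cats0.
  have := derives_one_var u v dC.
  by rewrite -!terminals_cat !catA.
(* No arc leaves the final vertex, so a terminating production ends the walk. *)
case: p IHp => [|c p] _ [BP /= ->] => [_|[]//]; rewrite right_word_cons /left_word /= !cats0.
by apply: rt_step; exists B, (terminals n u), [::], [::]; rewrite cats0.
Qed.

(** The context [u], [v] is arbitrary because it grows with each production in the induction. *)
Lemma derives_path u i v w :
  linear_grammar Gam -> derives Gam (one_var u i v) (terminals n w) ->
  exists p, is_path Gam (Some i) p None /\
            w = u ++ left_word p ++ right_word p ++ v.
Proof.
move=> hlin /(clos_rt_rt1n _ _ _ _).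
move es: (one_var u i v) => s; move et: (terminals n w) => t d.
elim: d u i v es et => {s t} [s|s s' t st d IHd] u i v es et.
  by have := var_notin_terminals i w; rewrite et -es mem_cat mem_head orbT.
rewrite -{}es in st.
case: (derives1_one_var hlin st) => [[u' [C [v' [iP e]]]]|[u' [iP e]]].
  have [p [pP ->]] := IHd _ _ _ (esym e) et.
  exists (DArc i (Some C) (u', v') :: p); split=> //.
  by rewrite right_word_cons /left_word /= -!catA.
exists [:: DArc i None (u', [::])]; split=> //.
rewrite right_word_cons /left_word /= cats0.
(* The form is already terminal, so the derivation cannot continue. *)
move: d; rewrite e -et => d; inversion d as [e'|s2 t2 st2].
  by apply/esym/(@terminals_inj m n).
by case: (derives1_terminals st2).
Qed.

Lemma languageP w :
  linear_grammar Gam ->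
  language Gam w <->
  exists p, is_path Gam (Some start) p None /\ w = left_word p ++ right_word p.
Proof.
move=> hlin; split=> [h|[p [pP ->]]]; last exact: path_derives.
have [p [pP ->]] := @derives_path [::] start [::] w hlin h.
by exists p; rewrite cats0.
Qed.

(** * Simple walks and removal of loops *)

Lemma mem_src_split b p :
  b \in [seq src a | a <- p] -> exists p1 a p2, p = p1 ++ a :: p2 /\ src a = b.
Proof.
elim: p => [//|a p IHp] /=; rewrite inE => /predU1P[->|/IHp[p1 [c [p2 [-> <-]]]]].
  by exists [::], a, p.
by exists (a :: p1), c, p2.
Qed.

(** Both sides list all vertices of the walk in order. *)
Lemma is_path_tgt_src j0 p j :
  is_path Gam j0 p j ->
  j0 :: [seq tgt a | a <- p] = rcons [seq Some v | v <- [seq src a | a <- p]] j.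
Proof.
elim: p j0 => [|a p IHp] j0 /=; first by move=> ->.
by case=> <- _ /IHp ->.
Qed.

(** The targets are the sources without the first, followed by [None], which is never a source. *)
Lemma uniq_src_tgt_final i p :
  is_path Gam (Some i) p None -> uniq [seq src a | a <- p] ->
  uniq [seq tgt a | a <- p].
Proof.
move=> /is_path_tgt_src e us.
suff /= /andP[]: uniq (Some i :: [seq tgt b | b <- p]) by [].
rewrite e rcons_uniq; apply/andP; split; first by apply/negP => /mapP[].
by rewrite (map_inj_uniq (@Some_inj _)).
Qed.

Lemma Dhat_final i p :
  is_path Gam (Some i) p None -> uniq [seq src a | a <- p] ->
  Dhat Gam i None p.
Proof.
move=> pP us; split; [split=> // | by [] | exact: uniq_src_tgt_final pP us].
by move=> e; rewrite e in pP.
Qed.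

(** On a closed walk the targets are the sources rotated by one place. *)
Lemma simple_loop a p :
  is_path Gam (Some (src a)) (a :: p) (Some (src a)) ->
  uniq [seq src b | b <- a :: p] -> C Gam (src a) (a :: p).
Proof.
move=> pP us; split=> //.
have := is_path_tgt_src pP; rewrite [in RHS]map_cons rcons_cons => -[e].
rewrite map_cons {}e rcons_uniq (map_inj_uniq (@Some_inj _)).
by rewrite (mem_map (@Some_inj _)).
Qed.

(* The loop that is cut out is the last one, so that what follows it is
   simple, as [Omega8] requires. *)
Lemma simple_or_loop i p :
  is_path Gam (Some i) p None ->
  uniq [seq src a | a <- p] \/
  exists k p1 p2 p3, [/\ p = p1 ++ p2 ++ p3, is_path Gam (Some i) p1 (Some k),
    C Gam k p2 & Dhat Gam k None p3].
Proof.
elim: p i => [//|a p IHp] i /= [[ei] aa pP].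
case ta: (tgt a) pP => [k|] pP; last by case: p IHp pP => [|c p] _ => [_|[]//]; left.
have [us|[l [p1 [p2 [p3 [-> p1P p2P p3P]]]]]] := IHp _ pP; last first.
  right; exists l, (a :: p1), p2, p3; split=> //=.
  by rewrite ei ta.
have [ap|nap] := boolP (src a \in [seq src b | b <- p]); last by left.
(* The tail is simple: its part before the return to [src a] forms with [a] a simple loop, and the
   rest is a simple walk. *)
right; have [q1 [b [q2 [ep eb]]]] := mem_src_split ap.
move: pP us; rewrite {}ep in ap * => /is_path_cat_src[]; rewrite eb => q1P q2P.
rewrite map_cat cat_uniq => /and3P[u1 dis u2].
exists (src a), [::], (a :: q1), (b :: q2); split=> //=; first by rewrite ei.
- apply: simple_loop; first by rewrite /= ta.
  rewrite /= u1 andbT; apply: contra dis => aq.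
  by rewrite /= eb aq.
- exact: Dhat_final.
Qed.

(** When the source of the first arc recurs in the shortened tail, everything before the recurrence
    is dropped. *)
Lemma path_uniq_src j0 p j :
  is_path Gam j0 p j ->
  exists q, is_path Gam j0 q j /\ uniq [seq src a | a <- q].
Proof.
elim: p j0 => [|a p IHp] j0 /=; first by exists [::].
case=> <- aa /IHp[q [qP uq]].
have [aq|naq] := boolP (src a \in [seq src b | b <- q]); last first.
  by exists (a :: q); rewrite /= naq.
have [q1 [b [q2 [eq eb]]]] := mem_src_split aq.
move: qP uq; rewrite {}eq => /is_path_cat_src[_]; rewrite eb => q2P.
by rewrite map_cat cat_uniq => /and3P[_ _ u2]; exists (b :: q2).
Qed.

(** * Walks with restricted intermediate vertices *)

Lemma K_walk k i j p : K Gam k i j p -> D Gam i j p.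
Proof.
elim: k i j p => [|k IHk] i j p /=.
  by move=> [a [-> aa <- <-]].
case=> [/IHk//|[p1 /IHk[p1N p1P] [p2 /IHk[p2N p2P] <-]]].
split; first by case: p1 p1N {p1P}.
by apply/is_path_cat; eexists; split; eassumption.
Qed.

(** This is the Floyd-Warshall decomposition. The sources of [p] are the intermediate vertices of
    [a :: p], so the endpoints stay free and loops are covered. If variable [k] occurs among them,
    it does so once, and the two pieces around it pass only through smaller variables. *)
Lemma walk_K k i j a p :
  k <= n.+1 -> is_path Gam (Some i) (a :: p) j ->
  uniq [seq src b | b <- p] -> all (fun v : 'I_n.+1 => v < k) [seq src b | b <- p] ->
  K Gam k i j (a :: p).
Proof.
elim: k i j a p => [|k IHk] i j a p.
  by case: p => [|//] _ [[ei] aa /= ej] _ _; exists a.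
move=> lekn apP us ltk; have [kp|nkp] := boolP (inord k \in [seq src b | b <- p]).
  right; have [p1 [b [p2 [ep eb]]]] := mem_src_split kp.
  rewrite {}ep in apP us ltk kp *.
  have [h1 h2] := @is_path_cat_src _ (a :: p1) _ _ _ apP.
  move: us ltk; rewrite map_cat cat_uniq all_cat => /and3P[u1 /= dis /andP[nb u2]].
  move=> /and3P[l1 _ l2]; rewrite eb in h1 h2 dis nb.
  have lt_k q : inord k \notin [seq src b | b <- q] ->
      all (fun v : 'I_n.+1 => v < k.+1) ([seq src b | b <- q]) ->
      all (fun v : 'I_n.+1 => v < k) ([seq src b | b <- q]).
    move=> nk /allP l; apply/allP => v vq; rewrite ltn_neqAle -ltnS l // andbT.
    by apply: contra nk => /eqP <-; rewrite inord_val.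
  exists (a :: p1).
    apply: IHk => //; first exact: ltnW.
    by apply: lt_k => //; case/norP: dis.
  exists (b :: p2) => //; apply: IHk => //; [exact: ltnW | exact: lt_k].
left; apply: IHk => //; first exact: ltnW.
apply/allP => v vp; rewrite ltn_neqAle -ltnS (allP ltk) // andbT.
by apply: contra nkp => /eqP <-; rewrite inord_val.
Qed.

Lemma Dhat_K i j p : Dhat Gam i j p -> K Gam n.+1 i j p.
Proof.
case: p => [[[]]//|a p] [[_ apP] us _].
have /andP[_ {}us] : uniq (src a :: [seq src b | b <- p]) := us.
by apply: walk_K => //; apply/allP.
Qed.

(** The walk [p1] of [Omega8] may itself lie outside [K]; a shortcut with the same ends meets the
    nonemptiness condition of [Omega10]. *)
Lemma walk_K_nonempty i j p : D Gam i j p -> K Gam n.+1 i j !=set0.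
Proof.
case: p => [[]//|a p] [_ [ei aa /path_uniq_src[q [qP uq]]]].
by exists (a :: q); apply: walk_K => //; apply/allP.
Qed.

End Walks.

(** * Labels of walks as values of words *)

Section Labels.
Context (G : groupType) (m n : nat) (x : 'I_m -> G).
Implicit Types p q : seq (darc m n).

Lemma l_UE p : l_U x p = (eval x (left_word p), eval x (right_word p)).
Proof.
elim: p => [|a p IHp] /=; first by rewrite /eval !big_nil.
by rewrite IHp right_word_cons /left_word /= /diamond !eval_cat.
Qed.

Lemma f_d_l_U p : f_d (l_U x p) = eval x (left_word p ++ right_word p).
Proof. by rewrite l_UE eval_cat. Qed.

Lemma l_U_cat p q : l_U x (p ++ q) = diamond (l_U x p) (l_U x q).
Proof.
elim: p => [|a p IHp] /=; first by rewrite /diamond mul1g mulg1; case: l_U.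
by rewrite IHp /diamond /= !mulgA.
Qed.

Lemma f_d_l_U_loop p1 p2 p3 :
  f_d (l_U x (p1 ++ p2 ++ p3)) =
  f_l (l_U x p1) * (f_l (l_U x p2) * f_d (l_U x p3) * f_r (l_U x p2)) *
  f_r (l_U x p1).
Proof. by rewrite !l_U_cat /f_d /f_l /f_r /= !mulgA. Qed.

Lemma f_d_l_U_base p1 p3 :
  f_d (l_U x (p1 ++ p3)) = f_l (l_U x p1) * f_d (l_U x p3) * f_r (l_U x p1).
Proof. by rewrite !l_U_cat /f_d /f_l /f_r /= !mulgA. Qed.

End Labels.

(** * Comparison of the conditions *)

Section Equivalences.
Context (G : groupType) (m : nat) (x : 'I_m -> G) (n : nat) (Gam : grammar m n).
Hypothesis hlin : linear_grammar Gam.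

(** Condition (i) read on the diagram, the form in which (iii) and (iv) are compared with it. *)
Definition trivial_walks : Prop :=
  forall p, is_path Gam (Some start) p None -> f_d (l_U x p) = 1.

Lemma trivial_walksP :
  language Gam `<=` identity_words x <-> trivial_walks.
Proof.
split=> [h p pP|h w /(languageP _ hlin)[p [pP ->]]].
  by rewrite f_d_l_U; apply: h; apply/languageP => //; exists p.
by rewrite /identity_words /= -f_d_l_U h.
Qed.

Lemma nonempty_walk :
  language Gam !=set0 -> exists p, is_path Gam (Some start) p None.
Proof. by move=> [w /(languageP _ hlin)[p [pP _]]]; exists p. Qed.

(** The walks with and without [p2] are both trivial. The loop is arbitrary, so this serves [Omega8]
    and also [Omega10], whose loops may repeat vertices. *)
Lemma trivial_loop i (p1 p2 p3 : seq (darc m n)) :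
  trivial_walks -> is_path Gam (Some start) p1 (Some i) ->
  is_path Gam (Some i) p2 (Some i) -> is_path Gam (Some i) p3 None ->
  angle (f_l (l_U x p2)) (f_d (l_U x p3)) (f_r (l_U x p2)) = 1.
Proof.
move=> h h1 h2 h3.
apply: (@angle_loop _ (f_l (l_U x p1)) (f_r (l_U x p1))).
- by rewrite -f_d_l_U_base; apply/h/is_path_cat; exists (Some i).
- rewrite -f_d_l_U_loop; apply/h/is_path_cat; exists (Some i); split=> //.
  by apply/is_path_cat; exists (Some i).
Qed.

Lemma trivial_W1 r :
  all_reachable Gam -> pumping_constant Gam (language Gam) r ->
  language Gam !=set0 -> language Gam `<=` identity_words x ->
  W1 x Gam (language Gam) r = [set 1].
Proof.
move=> hreach hr [z Lz] h; apply: subset1_eq.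
  (* Nonemptiness: a short word lies in [Omega1], and a long one yields by pumping a word of
     [Omega2]. *)
  have [zr|/ltnW rz] := leqP (size z) r; first by exists (eval x z), z => //; left.
  have [z1 [u [w [v [z2 [_ szr uv _ [B [_ d1 d2]]]]]]]] := hr z Lz rz.
  exists (eval x (u ++ w ++ v ++ inv_word w)); eexists; last by [].
  by right; exists u, w, v; split=> //; exists B.
move=> _ [t tO <-]; case: tO => [[Lt _]|]; first exact: h.
move=> [u [w [v [-> _ _ [B [dB dw]]]]]]; rewrite eval_Omega2 /=.
(* This context turns every word derived from [B] into a word of the language. *)
have [z1 [z2 dz]] := reachable_one_var hlin B hreach.
have Lw t' : derives Gam [:: inl B] (terminals n t') ->
    eval x z1 * eval x t' * eval x z2 = 1.
  move=> dt; rewrite -!eval_cat; apply: h; rewrite /language /= !terminals_cat -catA.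
  exact: rt_trans dz (derives_one_var _ _ dt).
apply: angle_loop (Lw _ dw) _; have := Lw (u ++ w ++ v).
rewrite !eval_cat (mulgA (eval x u)); apply; rewrite !terminals_cat.
exact: rt_trans dB (derives_one_var _ _ dw).
Qed.

(** Induction on the length of the word. The last clause of [pumping_constant] places the bracket of
    each removed loop in [Omega2]. *)
Lemma W1_trivial r :
  pumping_constant Gam (language Gam) r ->
  W1 x Gam (language Gam) r = [set 1] -> language Gam `<=` identity_words x.
Proof.
move=> hr hW z; have W1P t : (Omega1 (language Gam) r `|` Omega2 Gam r) t -> eval x t = 1.
  by move=> tO; have : W1 x Gam (language Gam) r (eval x t) by [exists t]; rewrite hW.
have [k] := ubnP (size z); elim: k z => // k IHk z szk Lz.
have [zr|/ltnW rz] := leqP (size z) r; first by apply: W1P; left.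
have [z1 [u [w [v [z2 [ez szr uv Lp [B [_ d1 d2]]]]]]]] := hr z Lz rz.
(* Exponent 0 deletes [u] and [v], which are not both empty, so the word gets shorter. *)
have : eval x (z1 ++ w ++ z2) = 1.
  apply: IHk (Lp 0); rewrite -ltnS; apply: leq_trans szk; rewrite ltnS ez !size_cat.
  have : 0 < size u + size v by rewrite -size_cat; case: (u ++ v) uv.
  by rewrite /=; lia.
have : eval x (u ++ w ++ v ++ inv_word w) = 1.
  by apply: W1P; right; exists u, w, v; split=> //; exists B.
rewrite eval_Omega2 => /angle_eq1 e; rewrite /identity_words /= ez !eval_cat.
by rewrite -[in X in X -> _]e !mulgA.
Qed.

Lemma trivial_W4 :
  language Gam !=set0 -> trivial_walks -> W4 x Gam = [set 1].
Proof.
move=> L0 h; apply: subset1_eq.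
  have [p /path_uniq_src[q [qP uq]]] := nonempty_walk L0.
  by exists (f_d (l_U x q)); left; exists q => //; apply: Dhat_final.
move=> t [[p [[_ pP] _ _] <-]|]; first exact: h.
move=> [i [p1 [p2 [p3 [[[_ h1] [[_ h2] _ _] [[_ h3] _ _]] _ ->]]]]].
exact: trivial_loop h1 h2 h3.
Qed.

Lemma W4_trivial : W4 x Gam `<=` [set 1] -> trivial_walks.
Proof.
move=> hW p; have [k] := ubnP (size p); elim: k p => // k IHk p spk pP.
have [us|[i [p1 [p2 [p3 [ep h1 h2 h3]]]]]] := simple_or_loop pP.
  by apply: hW; left; exists p => //; apply: Dhat_final.
have [[p2N p2P] _ _] := h2; have [[p3N p3P] _ _] := h3.
have /angle_eq1 e : angle (f_l (l_U x p2)) (f_d (l_U x p3)) (f_r (l_U x p2)) = 1.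
  (* Walks are nonempty in [Omega8]: when the loop is at the start, it also
     serves as the walk that leads to it. *)
  have [q1 [q1N q1P]] : exists q1, D Gam start (Some i) q1.
    case: p1 h1 {ep} => [[ei]|b p1 h1]; first by exists p2; rewrite ei.
    by exists (b :: p1).
  apply: hW; right; exists i, q1, p2, p3; split=> //; split; first by case: q1 q1N {q1P}.
  apply/is_path_cat; exists (Some i); split=> //.
  by apply/is_path_cat; exists (Some i).
(* The trivial bracket gives [p] the same value as [p1 ++ p3], which is shorter because [p2] is
   nonempty. *)
rewrite ep f_d_l_U_loop e -f_d_l_U_base; apply: IHk.
  rewrite -ltnS; apply: leq_trans spk; rewrite ltnS ep !size_cat ltn_add2l.
  by rewrite -[X in X < _]add0n ltn_add2r; case: p2 p2N {ep h2 p2P e}.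
by apply/is_path_cat; exists (Some i).
Qed.

Lemma trivial_W5 :
  language Gam !=set0 -> trivial_walks -> W5 x Gam = [set 1].
Proof.
move=> L0 h; apply: subset1_eq.
  have [p /path_uniq_src[q [qP uq]]] := nonempty_walk L0.
  exists (f_d (l_U x q)); left; exists (l_U x q) => //; exists q => //.
  by apply/Dhat_K/Dhat_final.
move=> t [[_ [p /K_walk[_ pP] <-] <-]|]; first exact: h.
move=> [i [[p1 /K_walk[_ h1]] _ _ [pp [pq [e2 e3 ->]]]]].
case: e2 e3 => [p2 /K_walk[_ h2] <-] [p3 /K_walk[_ h3] <-].
exact: trivial_loop h1 h2 h3.
Qed.

Lemma W4_sub_W5 : W4 x Gam `<=` W5 x Gam.
Proof.
move=> t [[p /Dhat_K pK <-]|].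
  by left; exists (l_U x p) => //; exists p.
move=> [i [p1 [p2 [p3 [[h1 /Dhat_K h2 /Dhat_K h3] _ ->]]]]].
right; exists i; split; [exact: walk_K_nonempty h1 | by exists p2 | by exists p3|].
by exists (l_U x p2), (l_U x p3); split=> //; [exists p2 | exists p3].
Qed.

End Equivalences.

Theorem theorem3p1 (G : groupType) (m : nat) (x : 'I_m -> G)
    (hgen : generating x) (hdec : decidable_word_problem x)
    (n : nat) (Gam : grammar m n) (hlin : linear_grammar Gam)
    (hreach : all_reachable Gam)
    (L : set (word m)) (hL : L = language Gam) (hL0 : L !=set0)
    (r : nat) (hr : pumping_constant Gam L r) :
  [<-> L `<=` identity_words x;
       W1 x Gam L r = [set 1];
       W4 x Gam = [set 1];
       W5 x Gam = [set 1]].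
Proof.
(* The implications are proved in a cycle; all but the first pass through [trivial_walks]. *)
subst L; tfae.
- exact: trivial_W1.
- by move=> /(W1_trivial hr)/(trivial_walksP x hlin); apply: trivial_W4.
- by move=> hW; apply: trivial_W5 => //; apply: W4_trivial; rewrite hW.
- move=> hW; apply/(trivial_walksP x hlin)/W4_trivial.
  by rewrite -hW; apply: W4_sub_W5.
Qed.
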